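(* Let $n, s \in \mathbb{Z}^+$ with $n \geq 2$ and $1 \leq s \leq n-2$, and let $M$ be some fixed multiset of size $n$. Let $A$ be the set of all permutations of $M$ (i.e. all words $a_1a_2\ldots a_n$ whose multiset of letters is $M$). If $\gcd(s,n) = 1$, then there is an $s$-overlap cycle for $A$.
   Context: An $s$-overlap cycle ($s$-ocycle) for a set of words of length $n$ is a cyclically ordered listing of the words in the set, each appearing exactly once, such that the last $s$ letters of each word are the first $s$ letters (in the same order) of its successor in the listing (the successor of the last word being the first word). *)

(* Defs.v *)
From mathcomp Require Import all_boot finmap multiset.

Set Implicit Arguments.
Unset Strict Implicit.
Unset Printing Implicit Defensive.

Local Open Scope mset_scope.

Definition overlap (T : eqType) (n s : nat) : rel (n.-tuple T) :=
  fun u v => drop (n - s) u == take s v.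

(* [cycle] wraps around, so a one-word listing must overlap with itself; the
   empty listing is an s-ocycle of the empty set only. *)
Definition ocycle (T : eqType) (n s : nat) (A : {pred n.-tuple T})
    (c : seq (n.-tuple T)) : Prop :=
  [/\ uniq c, c =i A & cycle (overlap s) c].

Definition mset_perms (T : choiceType) (n : nat) (M : {mset T}) :
    {pred n.-tuple T} :=
  [pred w : n.-tuple T | seq_mset w == M].
Arguments mset_perms {T} n M.

(* Main.v *)
Require Import Defs.
From mathcomp Require Import all_boot finmap multiset.
From mathcomp Require Import perm fingroup zify.

(** The words are the edges of a digraph on words of length [s].  Rotation by
    [s] covers the set of words by cycles of overlapping words.  If two words
    in different cycles have the same successors, exchanging their successors
    merges the two cycles; hence in a cover with the fewest cycles, overlapping
    words lie in the same cycle.  Words that differ only after their first [s]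
    letters are successors of a common word, so a cycle of such a cover is
    closed under rotation by [s], hence, as [gcd(s, n) = 1], under all
    rotations, and under the exchange of the last two letters, hence under all
    permutations. *)

Local Open Scope mset_scope.
Local Open Scope nat_scope.

(** By [r_difun], points with one common successor share all successors, so they may exchange images
    without leaving [r]. *)
Lemma perm_coarsest_cycles {X : finType} (r : rel X) (s0 : {perm X}) :
    (forall x, r x (s0 x)) ->
    (forall x y u v, r x u -> r x v -> r y u -> r y v) ->
  exists2 s : {perm X}, forall x, r x (s x) &
    forall x y, r x y -> porbit s x = porbit s y.
Proof.
move=> rs0 r_difun.
pose P (s : {perm X}) := [forall x, r x (s x)].
have Ps0 : P s0 by apply/forallP.
case: (@arg_minnP _ s0 P (fun s => #|porbits s|) Ps0) => s /forallP rs s_min.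
exists s => // x y rxy.
pose z := (s^-1)%g y.
have sz : s z = y by rewrite /z permKV.
have z_y : porbit s z = porbit s y by rewrite -sz -[s z]/(aperm z s) -(expg1 s)
  porbit_perm.
apply/eqP; rewrite -z_y eq_porbit_mem; apply: contraT => xz.
have neq_xz : x != z by apply: contraNneq xz => ->; rewrite porbit_id.
(* This product sends [x] to [y] and [z] to [s x]; as [x] and [z] lie in different cycles, it has
   one cycle fewer than [s]. *)
have /s_min : P (tperm x z * s)%g.
  apply/forallP => u; rewrite permM; case: tpermP => [->|->|_ _] //.
    by rewrite sz.
  by apply: (r_difun x z y) => //; rewrite -sz.
have := porbits_mul_tperm s x z; rewrite xz neq_xz /= addn2 addn1 => -[<-].
by rewrite ltnn.
Qed.

Lemma iter_rot1 {T : Type} (w : seq T) (k : nat) :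
  iter k (rot 1) w = rot (k %% size w) w.
Proof.
case: (posnP (size w)) => [/size0nil -> | w_gt0]; first by elim: k => //= k ->.
elim: k => [|k IH]; first by rewrite mod0n rot0.
rewrite iterS IH -rotD ?add1n ?ltn_pmod // -[in RHS]addn1 -modnDml addn1.
have := ltn_pmod k w_gt0; rewrite leq_eqVlt => /predU1P[->|lt].
  by rewrite modnn rot0 rot_size.
by rewrite (modn_small lt).
Qed.

(** By Bezout some multiple of [s] is 1 modulo [n], so repeating the rotation by [s] yields the
    rotation by 1. *)
Lemma rot_closed_coprime {T : Type} (P : seq T -> Prop) (n s : nat) :
    0 < s -> s < n -> 1 < n -> coprime s n ->
    (forall w, P w -> size w = n) -> (forall w, P w -> P (rot s w)) ->
  forall w, P w -> P (rot 1 w).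
Proof.
move=> s_gt0 lt_sn n_gt1 /eqP co_sn sizeP Prot w Pw.
have Piter k : P (iter (k * s) (rot 1) w).
  elim: k => [|k IH] //.
  rewrite mulSn iterD iter_rot1 (sizeP _ IH) modn_small //.
  exact: Prot.
have [km kn e _] := egcdnP n s_gt0.
by have := Piter km; rewrite e co_sn iter_rot1 (sizeP _ Pw) modnMDl modn_small.
Qed.

Lemma perm_closed_rot_swap {T : eqType} (P : seq T -> Prop) :
    (forall w, P w -> P (rot 1 w)) ->
    (forall a b w, P (w ++ [:: a; b]) -> P (w ++ [:: b; a])) ->
  forall u v, perm_eq u v -> P u -> P v.
Proof.
move=> Prot Pswap.
have Pcat x y : P (x ++ y) -> P (y ++ x).
  elim: x y => [|a x IH] y; first by rewrite cats0.
  by move=> /Prot; rewrite cat_cons rot1_cons -cats1 -catA => /IH; rewrite -catA.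
(* The letter [b] passes those of [u1] one at a time, from the right: rotate the adjacent pair to
   the end, swap it, rotate back. *)
have Pmove u1 : forall x b u2, P (x ++ u1 ++ b :: u2) -> P (x ++ b :: u1 ++ u2).
  elim/last_ind: u1 => // u1 a IH x b u2; rewrite !cat_rcons => Pw.
  apply: IH; rewrite catA; apply: (Pcat [:: b, a & u2]).
  have /Pswap : P ((u2 ++ x ++ u1) ++ [:: a; b]).
    by apply: (Pcat [:: a; b]); apply: (Pcat (x ++ u1) [:: a, b & u2]);
      rewrite -catA.
  by move/(Pcat (u2 ++ _) [:: b; a]).
(* The prefix [x] holds the letters already in place. *)
suff gen v : forall x u, perm_eq u v -> P (x ++ u) -> P (x ++ v).
  by move=> u v uv; apply: (gen v [::] u).
elim: v => [|b v IH] x u; first by move/perm_nilP => ->.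
move=> uv; have : b \in u by rewrite (perm_mem uv) mem_head.
move=> /path.splitPr u_b; case: u_b uv => u1 u2.
rewrite -(cat1s b u2) perm_catCA /= perm_cons => uv /Pmove Pw.
by rewrite -cat_rcons; apply: IH uv _; rewrite cat_rcons.
Qed.

Theorem lemma4p2 (T : choiceType) (n s : nat) (M : {mset T})
    (hn : 2 <= n) (hs1 : 1 <= s) (hs2 : s <= n - 2)
    (hM : size M = n) (hgcd : gcdn s n = 1) :
  exists c : seq (n.-tuple T), ocycle s (mset_perms n M) c.
Proof.
have le_sn : s <= n by apply: leq_trans hs2 (leq_subr _ _).
pose L : seq (n.-tuple T) := pmap insub (permutations M).
have memL w : (w \in L) = perm_eq w M by rewrite mem_pmap_sub mem_permutations.
(* Since [T] need not be finite, the words are packed into a finite type on which permutations make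
   sense. *)
pose X := seq_sub L.
pose tup (x : X) : n.-tuple T := ssval x.
have exX w : perm_eq w M -> exists x : X, tup x = w :> seq T.
  move=> wM; have sz_w : size w == n by rewrite (perm_size wM) hM.
  have wL : Tuple sz_w \in L by rewrite memL.
  by exists (SeqSub wL).
have XM x : perm_eq (tup x) M by rewrite -memL; exact: ssvalP.
(* [rotr] puts the last [s] letters in front, giving a successor of [x]. The default [x] is never
   returned, as rotating keeps the multiset. *)
pose rotX (x : X) : X := insubd x [tuple of rotr s (tup x)].
have rotXE x : tup (rotX x) = rotr s (tup x) :> seq T.
  rewrite /tup /rotX [ssval _](@insubdK _ _ X) //.
  by rewrite -topredE /= memL perm_rotr XM.
have tup_inj x y : tup x = tup y :> seq T -> x = y.
  by move=> xy; apply/val_inj/val_inj.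
have rotX_inj : injective rotX.
  move=> x y xy; apply/tup_inj/(can_inj (@rotrK s T)).
  by rewrite -!rotXE xy.
pose r : rel X := fun x y => overlap s (tup x) (tup y).
have [] := @perm_coarsest_cycles X r (perm rotX_inj).
- move=> x; rewrite permE /r /overlap rotXE /rotr size_tuple.
  by rewrite take_size_cat // size_drop size_tuple subKn.
- by move=> x y u v; rewrite /r /overlap => /eqP-> /eqP-> /eqP->.
move=> t rt rt_orb.
have [x0 _] := exX _ (perm_refl M).
pose P (w : seq T) := exists2 x, tup x = w :> seq T & porbit t x = porbit t x0.
have sizeP w : P w -> size w = n by case=> x <- _; rewrite size_tuple.
have PM w : P w -> perm_eq w M by case=> x <- _; exact: XM.
have Ppred w w' : P w -> perm_eq w' M -> drop (n - s) w' = take s w -> P w'.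
  case=> x <- xx0 /exX[y <-] /eqP ryx; exists y => //.
  by rewrite -xx0; apply: rt_orb.
have Psucc w w' : P w -> perm_eq w' M -> drop (n - s) w = take s w' -> P w'.
  case=> x <- xx0 /exX[y <-] /eqP rxy; exists y => //.
  by rewrite -xx0; apply/esym/rt_orb.
have drop_rot (w : seq T) : size w = n -> drop (n - s) (rot s w) = take s w.
  by move=> sz_w; rewrite /rot drop_size_cat // size_drop sz_w.
(* [rot s w] ends with the first [s] letters of [w], so it is a predecessor of [w]. *)
have Prot_s w : P w -> P (rot s w).
  by move=> Pw; apply: (Ppred w); rewrite ?perm_rot ?drop_rot ?PM ?sizeP.
have Prot : forall w, P w -> P (rot 1 w).
  by apply: (@rot_closed_coprime _ _ n s) => //; [lia | apply/eqP].
have Pswap a b w : P (w ++ [:: a; b]) -> P (w ++ [:: b; a]).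
  move=> Pw; have := sizeP _ Pw; rewrite size_cat /= => sz_w.
  (* As [s <= n - 2], the swap leaves the first [s] letters alone, so both words succeed the same
     rotated word. *)
  have le_sw : s <= size w by move: hs2; rewrite -sz_w addnK.
  apply: (Psucc _ _ (Prot_s _ Pw)); last first.
    by rewrite drop_rot ?sizeP // !takel_cat.
  by rewrite -(permPl (_ : perm_eq (w ++ [:: a; b]) _)) ?PM // perm_cat2l
    (perm_catC [:: a] [:: b]).
have Pall x : porbit t x = porbit t x0.
  have [||y /tup_inj <- //] := perm_closed_rot_swap P Prot Pswap (tup x0) (tup x).
    by rewrite (perm_trans (XM x0)) // perm_sym XM.
  by exists x0.
(* The cycle of [x0] under [t] contains every word, so its orbit is the listing. *)
exists [seq tup x | x <- orbit t x0]; split.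
- by rewrite map_inj_uniq ?orbit_uniq // => x y xy; apply: tup_inj; rewrite xy.
- move=> w; have -> : (w \in mset_perms n M) = perm_eq w M.
    by rewrite inE -[in LHS](seq_mset_id M); apply/eqP/eq_seq_msetP.
  apply/mapP/idP => [[x _ ->] | /exX[x xw]]; first exact: XM.
  exists x; last exact/val_inj.
  rewrite -fconnect_orbit.
  have : x \in porbit t x0 by rewrite -eq_porbit_mem Pall.
  by case/porbitP => i ->; rewrite permX fconnect_iter.
- apply: homo_cycle (cycle_orbit (@perm_inj _ t) x0).
  by move=> x y /= /eqP <-; exact: rt.
Qed.
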